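(* Let $F$ be an absolutely continuous df with pdf $f$, let $\tau$ be a positive-valued random variable, and for each positive integer $k$ let $B_k(x)=\sum_{i=0}^{k-1}\frac{(-\log F(x))^i}{i!}E_\tau\left(\tau^iF^\tau(x)\right)$. Then: (a) $B_k$ is a df with $r(B_k)=r(F)$, with pdf $b_k(x)=\frac{(-\log F(x))^{k-1}}{(k-1)!}E_\tau\left(\tau^kF^{\tau-1}(x)\right)f(x)$, and satisfying the recurrence relation $B_{k+1}(x)=B_k(x)+\frac{(-\log F(x))^k}{k!}E_\tau\left(\tau^kF^\tau(x)\right)$, $x\in\{y\in\mathbb{R}:F(y)>0\}$; (b) $B_k$ is tail equivalent to $H_k$, where $H_k(x)=1-(1-F(x))^k$, $x\in\mathbb{R}$.
   Context: df means distribution function on $\mathbb{R}$, pdf means probability density function; dfs are specified only at those $x$ where their values lie in $(0,1)$. $E_\tau$ denotes expectation with respect to the distribution of $\tau$. For a df $F$, $r(F)=\sup\{x\in\mathbb{R}:F(x)<1\}$ is its right extremity. Two dfs $A,B$ are tail equivalent if $r(A)=r(B)$ and $\frac{1-A(x)}{1-B(x)}$ tends to a limit in $(0,\infty)$ as $x\uparrow r(A)$.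
   Formalization: Part (b) is proved under the added assumption that E(τ^k) is finite; without it (b) fails, e.g. for k=1, F uniform on [0,1] and E(τ) infinite, since then (1-B_1)/(1-H_1) tends to infinity. *)

(* Defs.v *)
From HB Require Import structures.
From mathcomp Require Import all_boot all_order all_algebra.
From mathcomp Require Import all_classical all_reals all_analysis.
Import Order.TTheory GRing.Theory Num.Theory.
Import numFieldNormedType.Exports.

Set Implicit Arguments.
Unset Strict Implicit.
Unset Printing Implicit Defensive.

Local Open Scope classical_set_scope.
Local Open Scope ring_scope.

Definition is_df (R : realType) (F : R -> R) : Prop :=
  exists G : cumulativeBounded (0 : R) (1 : R), F = G :> (R -> R).

(* [is_df F /\ is_pdf F f] says that F is an absolutely continuous df
   with density f. *)
Definition is_pdf (R : realType) (F f : R -> R) : Prop :=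
  [/\ measurable_fun [set: R] f,
      forall x, 0 <= f x &
      forall x, (F x)%:E =
        (\int[@lebesgue_measure R]_(y in [set` `]-oo, x]]) (f y)%:E)%E].

Definition right_extremity (R : realType) (F : R -> R) : \bar R :=
  ereal_sup [set x%:E | x in [set x : R | F x < 1]].

(* The filter of x increasing to r.  The right extremity of a df is never -oo;
   that case is filled in only for totality. *)
Definition increasing_to (R : realType) (r : \bar R) : set_system R :=
  match r with
  | r'%:E => at_left r'
  | +oo%E => pinfty_nbhs R
  | -oo%E => ninfty_nbhs R
  end.

Definition tail_equivalent (R : realType) (A B : R -> R) : Prop :=
  right_extremity A = right_extremity B /\
  exists2 l : R, 0 < l &
    (1 - A x) / (1 - B x) @[x --> increasing_to (right_extremity A)] --> l.

Section mixture.
Context d (T : measurableType d) (R : realType) (P : probability T R).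
Variables (F f : R -> R) (tau : T -> R).

(* When 0 < F x < 1 the integrands in [Bk] and [bk] are bounded, so [fine]
   loses nothing.  When F x = 0, the conventions ln 0 = 0 and 0 `^ t = 0 for
   t != 0 make [Bk] equal to 0.  When F x = 1, the moments of tau occurring in
   [Bk] may be infinite, but those of positive order are multiplied by 0, and
   [Bk] equals 1.  The values of [bk] where F x is 0 or 1 are immaterial, since
   f vanishes almost everywhere there. *)
Definition Bk (k : nat) (x : R) : R :=
  \sum_(i < k) (- ln (F x)) ^+ i / (i`!)%:R *
    fine 'E_P[(fun w => tau w ^+ i * F x `^ tau w)%R]%E.

Definition bk (k : nat) (x : R) : R :=
  (- ln (F x)) ^+ k.-1 / (k.-1`!)%:R *
    fine 'E_P[(fun w => tau w ^+ k * F x `^ (tau w - 1))%R]%E * f x.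

Definition Hk (k : nat) (x : R) : R := 1 - (1 - F x) ^+ k.

End mixture.

(* Main.v *)
Require Import Defs.
From HB Require Import structures.
From mathcomp Require Import all_boot all_order all_algebra.
From mathcomp Require Import all_classical all_reals all_analysis.
From mathcomp Require Import measurable_realfun ring lra.
Import Order.TTheory GRing.Theory Num.Theory.
Import numFieldNormedType.Exports.

(* With [L = - ln u], the sum defining [B_k] at [u = F x] is the mean over tau
   of the Erlang tail [exp (- y) * \sum_(i < k) y ^+ i / i!] at [y = tau * L],
   so that [B_k = M \o F] where the mixture [M] does not depend on [F].  The sum
   telescopes under differentiation, hence [M] has on (0, 1) the derivative [m]
   with [b_k = m (F x) * f x], and Tonelli gives [M v = \int_[0, v] m].  Since
   [F] is continuous, it transports the law with density [f] to the uniform law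
   on [0, 1]; this turns [\int_]-oo, x] m (F y) f y dy] into
   [\int_[0, F x] m = B_k x] without any chain rule for [M \o F].
   For the tail, [1 - tail y] lies between [exp (- y) * y ^+ k / k!] and
   [y ^+ k / k!], so by dominated convergence
   [(1 - M u) / L ^+ k --> E[tau ^+ k] / k!], while [L / (1 - u) --> 1]. *)

Set Implicit Arguments.
Unset Strict Implicit.
Unset Printing Implicit Defensive.

Local Open Scope classical_set_scope.
Local Open Scope ring_scope.

(** * Erlang tails *)

Section erlang.
Context {R : realType}.
Implicit Types y t u : R.

Definition poisson_weight (i : nat) y : R := expR (- y) * (y ^+ i / i`!%:R).

Definition erlang_tail (k : nat) y : R := \sum_(i < k) poisson_weight i y.

Lemma erlang_tailS k y :
  erlang_tail k.+1 y = erlang_tail k y + poisson_weight k y.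
Proof. by rewrite /erlang_tail big_ord_recr. Qed.

Lemma factr_neq0 k : (k`!%:R : R) != 0.
Proof. by rewrite pnatr_eq0 -lt0n fact_gt0. Qed.

Lemma factSr k : (k.+1`!%:R : R) = k.+1%:R * k`!%:R.
Proof. by rewrite factS natrM. Qed.

Lemma is_derive_powdivfact k y :
  is_derive y 1 (fun z : R => z ^+ k.+1 / k.+1`!%:R) (y ^+ k / k`!%:R).
Proof.
have -> : (fun z : R => z ^+ k.+1 / k.+1`!%:R) = (k.+1`!%:R^-1 \*: (@id R) ^+ k.+1).
  by apply/funext => z; rewrite /= mulrC fctE.
apply: is_derive_eq; rewrite /= /GRing.scale/= mulr1 factSr.
have := factr_neq0 k; have : (k.+1%:R : R) != 0 by rewrite pnatr_eq0.
by move=> ? ?; field; apply/andP.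
Qed.

Lemma is_derive_expRN y :
  is_derive y 1 (fun z => expR (- z)) (- expR (- y)).
Proof.
have := @is_derive1_comp R expR -%R y (expR (- y)) (-1).
rewrite /= mulrN1; apply; exact: is_deriveNid.
Qed.

Lemma is_derive_poisson_weightS k y :
  is_derive y 1 (poisson_weight k.+1)
    (poisson_weight k y - poisson_weight k.+1 y).
Proof.
have h1 := is_derive_expRN y; have h2 := is_derive_powdivfact k y.
apply: (@is_derive_eq _ _ _ (poisson_weight k.+1) y 1 _ _ (is_deriveM h1 h2)).
by rewrite /poisson_weight /GRing.scale /=; ring.
Qed.

(** Each weight of index [i.+1] has derivative weight [i] minus weight [i.+1], so only the last
    weight survives in the sum. *)
Lemma is_derive_erlang_tail k y :
  is_derive y 1 (erlang_tail k.+1) (- poisson_weight k y).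
Proof.
elim: k => [|k IH].
  have -> : erlang_tail 1 = fun z => expR (- z).
    apply/funext => z; rewrite /erlang_tail big_ord_recl big_ord0 addr0.
    by rewrite /poisson_weight expr0 divr1 mulr1.
  rewrite /poisson_weight expr0 divr1 mulr1; exact: is_derive_expRN.
have -> : erlang_tail k.+2 = erlang_tail k.+1 + poisson_weight k.+1.
  by apply/funext => z; rewrite erlang_tailS.
apply: (is_derive_eq (is_deriveD IH (is_derive_poisson_weightS k y))).
ring.
Qed.

Lemma continuous_poisson_weight k : continuous (poisson_weight k).
Proof.
move=> y; apply: cvgM.
  apply: (@continuous_comp _ _ _ -%R); first exact: opp_continuous.
  exact: continuous_expR.
by apply: cvgM; [exact: exprn_continuous|exact: cvg_cst].
Qed.

Lemma continuous_erlang_tail k : continuous (erlang_tail k).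
Proof.
elim: k => [|k IH] y.
  have -> : erlang_tail 0 = cst 0.
    by apply/funext => z; rewrite /erlang_tail big_ord0.
  exact: cvg_cst.
have -> : erlang_tail k.+1 = fun z => erlang_tail k z + poisson_weight k z.
  by apply/funext => z; rewrite erlang_tailS.
by apply: cvgD; [exact: IH|exact: continuous_poisson_weight].
Qed.

Lemma poisson_weight_ge0 k y : 0 <= y -> 0 <= poisson_weight k y.
Proof.
by move=> y0; rewrite /poisson_weight mulr_ge0 ?expR_ge0// divr_ge0// exprn_ge0.
Qed.

Lemma poisson_weight_gt0 k y : 0 < y -> 0 < poisson_weight k y.
Proof.
move=> y0; rewrite /poisson_weight mulr_gt0 ?expR_gt0// divr_gt0 ?exprn_gt0//.
Qed.

Lemma erlang_tail0 k : erlang_tail k.+1 0 = 1.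
Proof.
elim: k => [|k IH]; rewrite erlang_tailS ?IH.
  rewrite /erlang_tail big_ord0 /poisson_weight oppr0 expR0 expr0.
  by rewrite divr1 add0r mulr1.
by rewrite /poisson_weight expr0n mul0r mulr0 addr0.
Qed.

Lemma erlang_tail_ge0 k y : 0 <= y -> 0 <= erlang_tail k y.
Proof. by move=> y0; apply: sumr_ge0 => i _; exact: poisson_weight_ge0. Qed.

Lemma erlang_tail_nincr k y1 y2 : 0 <= y1 -> y1 <= y2 ->
  erlang_tail k y2 <= erlang_tail k y1.
Proof.
case: k => [*|k]; first by rewrite /erlang_tail !big_ord0.
apply: ler0_derive1_nincry => [y _|y|].
- by have [] := is_derive_erlang_tail k y.
- rewrite in_itv/= andbT => /ltW y0.
  rewrite derive1E (@derive_val _ _ _ _ _ _ _ (is_derive_erlang_tail k y)).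
  by rewrite oppr_le0 poisson_weight_ge0.
- exact/continuous_subspaceT/continuous_erlang_tail.
Qed.

Lemma erlang_tail_le1 k y : 0 <= y -> erlang_tail k y <= 1.
Proof.
case: k => [|k] y0; first by rewrite /erlang_tail big_ord0.
by rewrite -(erlang_tail0 k) erlang_tail_nincr.
Qed.

Lemma poisson_weight_le k y : 0 <= y -> poisson_weight k y <= 1 - erlang_tail k y.
Proof. by move=> y0; rewrite lerBrDl -erlang_tailS erlang_tail_le1. Qed.

Lemma poisson_weight_le1 k y : 0 <= y -> poisson_weight k y <= 1.
Proof.
by move=> y0; rewrite (le_trans (poisson_weight_le k y0))// gerBl erlang_tail_ge0.
Qed.

Lemma erlang_tail_lt1 k y : 0 < y -> erlang_tail k y < 1.
Proof.
move=> y0; rewrite -subr_gt0 (lt_le_trans (poisson_weight_gt0 k y0))//.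
by rewrite poisson_weight_le// ltW.
Qed.

(** For positive order, the tail plus the power term equals 1 at 0, and its derivative is a
    nonnegative power term times [1 - expR (- z)], hence it never drops below 1. *)
Lemma onem_erlang_tail_le k y : 0 <= y -> 1 - erlang_tail k y <= y ^+ k / k`!%:R.
Proof.
case: k => [|k] y0.
  by rewrite /erlang_tail big_ord0 expr0 divr1 subr0.
rewrite lerBlDl.
pose f := erlang_tail k.+1 + (fun z : R => z ^+ k.+1 / k.+1`!%:R).
have df (z : R) : is_derive z 1 f (- poisson_weight k z + z ^+ k / k`!%:R).
  by apply: is_deriveD; [exact: is_derive_erlang_tail|exact: is_derive_powdivfact].
suff : f 0 <= f y by rewrite /f/= !fctE erlang_tail0 expr0n mul0r addr0.
apply: (@ger0_derive1_ndecry _ f 0) => // [z|].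
- rewrite in_itv/= andbT => /ltW z0.
  rewrite derive1E (@derive_val _ _ _ _ _ _ _ (df z)) addrC subr_ge0.
  rewrite /poisson_weight ler_piMl// ?divr_ge0 ?exprn_ge0//.
  by rewrite -expR0 ler_expR oppr_le0.
- apply/continuous_subspaceT => z; apply: differentiable_continuous.
  by apply/derivable1_diffP; have [] := df z.
Qed.

(** Multiplying by [y] shifts a weight to the next index at the cost of a factor [i.+1], and weights
    are at most 1. The resulting O(1/y) decay gives continuity of the kernel at [u = 0]. *)
Lemma erlang_tail_decay k y : 0 <= y -> y * erlang_tail k y <= \sum_(i < k) i.+1%:R.
Proof.
move=> y0; rewrite /erlang_tail mulr_sumr; apply: ler_sum => i _.
have -> : y * poisson_weight i y = i.+1%:R * poisson_weight i.+1 y.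
  rewrite /poisson_weight factSr exprS.
  have := factr_neq0 i; have : (i.+1%:R : R) != 0 by rewrite pnatr_eq0.
  by move=> ? ?; field; apply/andP.
by rewrite ler_piMr// poisson_weight_le1.
Qed.

End erlang.

(** * The probability integral transform *)

(** The proofs about [f] are arguments so that the measure and finite-measure structures below can
    be attached to the term itself. *)
Definition density_measure d (T : measurableType d) (R : realType)
    (mu : {measure set T -> \bar R}) (f : T -> R)
    (intf : mu.-integrable [set: T] (EFin \o f)) (f_ge0 : forall x, 0 <= f x)
    (A : set T) : \bar R := (\int[mu]_(x in A) (f x)%:E)%E.

Section density_measure.
Context d (T : measurableType d) (R : realType).
Variables (mu : {measure set T -> \bar R}) (f : T -> R).
Hypothesis intf : mu.-integrable [set: T] (EFin \o f).
Hypothesis f_ge0 : forall x, 0 <= f x.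
Local Open Scope ereal_scope.

Local Notation nu := (density_measure intf f_ge0).

Let nu0 : nu set0 = 0. Proof. by rewrite /nu integral_set0. Qed.

Let nu_ge0 A : 0 <= nu A.
Proof. by apply: integral_ge0 => x _; rewrite lee_fin. Qed.

Let nu_sigma_additive : semi_sigma_additive nu.
Proof.
apply: semi_sigma_additive_nng_induced => [|x]; last by rewrite lee_fin.
exact: measurable_int intf.
Qed.

HB.instance Definition _ := isMeasure.Build _ _ _ nu
  nu0 nu_ge0 nu_sigma_additive.

Let nu_fin : fin_num_fun nu.
Proof.
by move=> A mA; apply: integrable_fin_num => //; exact: integrableS intf.
Qed.

HB.instance Definition _ := Measure_isFinite.Build _ _ _ nu nu_fin.

End density_measure.

(** The measure with density [f] is dominated by [mu]. Its Radon-Nikodym derivative and [f] have the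
    same integral over every measurable set, so they agree almost everywhere, and the change of
    variables for the derivative applies to [f]. *)
Lemma ge0_integral_density d (T : measurableType d) (R : realType)
    (mu : {sigma_finite_measure set T -> \bar R}) (f : T -> R)
    (intf : mu.-integrable [set: T] (EFin \o f)) (f_ge0 : forall x, 0 <= f x)
    (h : T -> \bar R) (D : set T) :
  (forall x, 0 <= h x)%E -> measurable D -> measurable_fun D h ->
  (\int[density_measure intf f_ge0]_(x in D) h x =
   \int[mu]_(x in D) (h x * (f x)%:E))%E.
Proof.
move=> h0 mD mh.
pose nu : {finite_measure set T -> \bar R} := density_measure intf f_ge0.
have numu : nu `<< mu.
  apply/null_content_dominatesP => A mA muA0.
  apply: null_set_integral => //.
  exact: measurable_funTS (measurable_int _ intf).
rewrite -(Radon_Nikodym_SigmaFinite.change_of_variables numu)//.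
have mf := measurable_int _ intf.
have mg := measurable_int _ (Radon_Nikodym_SigmaFinite.f_integrable numu).
apply: ae_eq_integral => //.
- by apply: emeasurable_funM => //; exact: measurable_funTS mg.
- by apply: emeasurable_funM => //; exact: measurable_funTS mf.
apply: ae_eqe_mul2l.
apply: integral_ae_eq => //.
- by apply: integrableS (Radon_Nikodym_SigmaFinite.f_integrable numu).
- exact: measurable_funTS mf.
by move=> E _ mE; rewrite -Radon_Nikodym_SigmaFinite.f_integral.
Qed.

(** The intervals []a, b]] form a generating class stable under intersection. Each is a difference
    of two half-lines, and finiteness permits the subtraction of their measures. *)
Lemma measure_unique_itvNyc (R : realType)
    (m1 m2 : {measure set (measurableTypeR R) -> \bar R}) :
  (m1 [set: R] < +oo)%E -> (m2 [set: R] < +oo)%E ->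
  (forall b : R, m1 [set` `]-oo, b]] = m2 [set` `]-oo, b]]) ->
  forall A, measurable A -> m1 A = m2 A.
Proof.
move=> m1oo m2oo m12 A mA.
have moo (m : {measure set (measurableTypeR R) -> \bar R})
    (B : set (measurableTypeR R)) :
    (m [set: R] < +oo)%E -> measurable B -> (m B < +oo)%E.
  by move=> mT mB; rewrite (le_lt_trans _ mT)// le_measure ?inE.
apply: (@measure_unique _ R (measurableTypeR R) (@ocitv R)
  (fun n => `]- n%:R, n%:R]%classic)) => //.
- exact: ocitvI.
- by move=> n; exact: is_ocitv.
- exact: (bigcup_itvT false false).
- move=> _ [[a b] _ <-].
  have [ab|ba] := leP a b; last first.
    by rewrite set_itv_ge ?measure0// bnd_simp -leNgt ltW.
  have -> : [set` `](a, b).1, (a, b).2]] = [set` `]-oo, b]] `\` [set` `]-oo, a]].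
    by rewrite -[RHS]setCK setCD setCitvl setUC -[LHS]setCK setCitv.
  have mD (m : {measure set (measurableTypeR R) -> \bar R}) :
      (m [set: R] < +oo)%E ->
      m ([set` `]-oo, b]] `\` [set` `]-oo, a]]) =
      (m [set` `]-oo, b]] - m [set` `]-oo, a]])%E.
    move=> mT; rewrite measureD; [|exact: measurable_itv|exact: measurable_itv|].
      by congr (_ - m _)%E; rewrite setIidr//; exact: subset_itvl.
    by apply: moo => //; exact: measurable_itv.
  by rewrite (mD _ m1oo) (mD _ m2oo) !m12.
- by move=> n; exact: moo.
Qed.

Section df.
Context {R : realType} (F : R -> R).
Hypothesis F_df : is_df F.

Lemma df_nondecreasing : {homo F : x y / x <= y}.
Proof. by have [G ->] := F_df; exact: cumulative_is_nondecreasing. Qed.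

Lemma df_cvgNy : F @ -oo --> (0 : R).
Proof. by have [G ->] := F_df; exact: cumulativeNy. Qed.

Lemma df_cvgy : F @ +oo --> (1 : R).
Proof. by have [G ->] := F_df; exact: cumulativey. Qed.

Lemma df_ge0 x : 0 <= F x.
Proof.
apply: (cvgr_to_le df_cvgNy); near=> y; apply: df_nondecreasing.
by near: y; apply: nbhs_ninfty_le; exact: num_real.
Unshelve. all: by end_near. Qed.

Lemma df_le1 x : F x <= 1.
Proof.
apply: (cvgr_to_ge df_cvgy); near=> y; apply: df_nondecreasing.
by near: y; apply: nbhs_pinfty_ge; exact: num_real.
Unshelve. all: by end_near. Qed.

End df.

Section pdf.
Context {R : realType} (F f : R -> R).
Hypotheses (F_df : is_df F) (F_pdf : is_pdf F f).
Local Notation mu := (@lebesgue_measure R).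

Let mf : measurable_fun [set: R] f. Proof. by case: F_pdf. Qed.
Let f_ge0 x : 0 <= f x. Proof. by case: F_pdf. Qed.

(** Monotone convergence along the half-lines up to [n], on which the integral is [F n], at most
    1. *)
Lemma pdf_integrable : mu.-integrable [set: R] (EFin \o f).
Proof.
apply/integrableP; split; first exact/measurable_EFinP.
under eq_integral do rewrite /= ger0_norm//.
have mE : measurable_fun [set: R] (EFin \o f) by exact/measurable_EFinP.
pose I n := `]-oo, (n%:R : R)]%classic.
have IT : \bigcup_n I n = [set: R].
  rewrite -subTset => x _; exists (Num.bound `|x|) => //=.
  by rewrite /I/= in_itv/= ltW// (le_lt_trans (ler_norm _))// archi_boundP.
rewrite -IT.
have : (\int[mu]_(x in I n) (f x)%:E)%E @[n --> \oo] -->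
       (\int[mu]_(x in \bigcup_n I n) (f x)%:E)%E.
  apply: ge0_nondecreasing_set_cvg_integral => //.
  - by move=> m n mn; apply/subsetPset/subset_itvl; rewrite bnd_simp ler_nat.
  - by move=> n; exact: measurable_itv.
  - by move=> n; exact: measurable_funTS mE.
  - by move=> n x _; rewrite lee_fin.
move=> /cvg_lim <- //; apply: (@le_lt_trans _ _ 1%E); last exact: ltry.
apply: lime_le.
  apply: ereal_nondecreasing_is_cvgn => m n mn.
  apply: ge0_subset_integral => //.
  - exact: measurable_itv.
  - exact: measurable_itv.
  - exact: measurable_funTS mE.
  - by move=> x _; rewrite lee_fin.
  - by apply: subset_itvl; rewrite bnd_simp ler_nat.
apply: nearW => n; have [_ _ <-] := F_pdf.
by rewrite lee_fin df_le1.
Qed.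

(** To the right of [x - 1], [F] is a constant plus an integral with variable upper bound. The base
    point [x - 1] makes [x] interior to the interval on which that integral is known to be
    continuous. *)
Lemma pdf_continuous : continuous F.
Proof.
have [_ _ FE] := F_pdf.
move=> x.
have intS (A : set R) : measurable A -> mu.-integrable A (EFin \o f).
  by move=> mA; exact: integrableS pdf_integrable.
have x1 : x - 1 < x + 1 by lra.
have Fint y : x - 1 <= y ->
    F y = F (x - 1) + (\int[mu]_(t in `[x - 1, y]) f t)%R.
  move=> xy; rewrite -Rintegral_itv_obnd_cbnd; last exact: intS.
  rewrite -(@Rintegral_itvB _ f -oo%O (BRight y) (x - 1))//; last exact: intS.
  have FR z : F z = (\int[mu]_(t in `]-oo, z]) f t)%R.
    by rewrite /Rintegral -FE.
  by rewrite -!FR; lra.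
have := parameterized_integral_continuous (ltW x1)
  (intS `[x - 1, x + 1]%classic (measurable_itv _)).
move=> /(continuous_within_itvP _ x1)[+ _ _] => /(_ x).
rewrite in_itv/= => /(_ ltac:(apply/andP; split; lra)) cx.
have : (fun y => F (x - 1) + parameterized_integral mu (x - 1) y f) @ x -->
    F (x - 1) + parameterized_integral mu (x - 1) x f.
  by apply: cvgD; [exact: cvg_cst|exact: cx].
rewrite {2}/parameterized_integral -Fint; last lra.
apply: cvg_trans; apply: near_eq_cvg; near=> y.
rewrite /parameterized_integral -Fint//.
by apply/ltW; near: y; apply: lt_nbhsr; lra.
Unshelve. all: by end_near. Qed.

End pdf.

Section probability_integral_transform.
Context {R : realType} (F f : R -> R).
Hypotheses (F_df : is_df F) (F_pdf : is_pdf F f).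
Local Notation mu := (@lebesgue_measure R).

Let F_cont := pdf_continuous F_df F_pdf.
Let F_nd := df_nondecreasing F_df.

(** The endpoint is the supremum of the sublevel set, finite because [F] exceeds [b < 1] somewhere;
    the one-sided limits of the continuous [F] there squeeze its value to [b]. *)
Lemma df_sublevel (b : R) : 0 <= b -> b < 1 ->
  [set y | F y <= b] = set0 \/
  exists2 s, [set y | F y <= b] = [set` `]-oo, s]] & F s = b.
Proof.
move=> b0 b1; set A := [set y | F y <= b].
have [->|/set0P[a Aa]] := eqVneq A set0; [by left|right].
have [z Fz] : exists z, b < F z.
  near (pinfty_nbhs R) => z; exists z; near: z.
  exact: (cvgr_gt _ (df_cvgy F_df)).
have zub : ubound A z.
  move=> y Fy; rewrite leNgt; apply/negP => /ltW/F_nd.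
  by rewrite leNgt (le_lt_trans Fy Fz).
have supA : has_sup A by split; [exists a|exists z].
have lt_sup y : y < sup A -> F y <= b.
  move=> /(sup_gt (ex_intro _ a Aa))[c Ac yc].
  by rewrite (le_trans _ Ac)// F_nd// ltW.
have gt_sup y : sup A < y -> b < F y.
  move=> yA; rewrite ltNge; apply/negP => Fy.
  by move: yA; rewrite ltNge (ub_le_sup supA.2 Fy).
have Fsup : F (sup A) = b.
  apply/eqP; rewrite eq_le; apply/andP; split.
    have cl : F y @[y --> (sup A)^'-] --> F (sup A).
      by apply: cvg_at_left_filter; exact: F_cont.
    apply: (cvgr_to_le cl).
    by near=> y; apply: lt_sup; near: y; exact: nbhs_left_lt.
  have cr : F y @[y --> (sup A)^'+] --> F (sup A).
    by apply: cvg_at_right_filter; exact: F_cont.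
  apply: (cvgr_to_ge cr).
  by near=> y; apply/ltW/gt_sup; near: y; exact: nbhs_right_gt.
exists (sup A) => //; apply/seteqP; split => y /=; rewrite in_itv/=.
  by move=> Fy; exact: (ub_le_sup supA.2).
by move=> /F_nd; rewrite Fsup.
Unshelve. all: by end_near. Qed.

(** This is the distribution function of [F] under the law with density [f] cut at [x]. If
    [F x <= b] the sublevel condition is void on the half-line; otherwise [b < 1], and the sublevel
    set is a half-line of mass [b], or empty, which forces [b = 0] since [F] tends to 0 at [-oo]. *)
Lemma pdf_sublevel (x b : R) : 0 <= b ->
  (\int[mu]_(y in [set` `]-oo, x]] `&` [set y | (F y <= b)%R]) (f y)%:E =
   (Num.min (F x) b)%:E)%E.
Proof.
move=> b0; have [_ _ FE] := F_pdf.
have [Fxb|bFx] := leP (F x) b.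
  rewrite FE; congr (\int[mu]_(y in _) _)%E; apply: setIidl => y /=.
  by rewrite in_itv/= => /F_nd yx; rewrite (le_trans yx).
have [Fb|[s -> bE]] := df_sublevel b0 (lt_le_trans bFx (df_le1 F_df x)).
  rewrite Fb setI0 integral_set0; congr (_%:E); apply/eqP.
  rewrite eq_le b0 /= leNgt; apply/negP => b_gt0.
  near (ninfty_nbhs R) => y.
  suff : set0 y by [].
  rewrite -Fb /=; near: y.
  exact: (cvgr_le _ (df_cvgNy F_df)).
have -> : [set` `]-oo, x]] `&` [set` `]-oo, s]] = [set` `]-oo, s]].
  apply: setIidr; apply: subset_itvl; rewrite bnd_simp leNgt.
  by apply/negP => /ltW/F_nd; rewrite leNgt bE bFx.

by rewrite -FE bE.
Unshelve. all: by end_near. Qed.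

(** The image under [F] of the law with density [f1] and the law with density [f2] are finite
    measures that agree on half-lines by [pdf_sublevel], hence are equal; both sides are the
    integral of [h] against them. Flat stretches of [F] cause no trouble, as no inverse of [F]
    enters. *)
Lemma ge0_integral_df_comp (h : R -> \bar R) (x : R) : measurable_fun [set: R] h ->
  (forall u, 0 <= h u)%E ->
  (\int[mu]_(y in [set` `]-oo, x]]) (h (F y) * (f y)%:E) =
   \int[mu]_(u in [set` `[0%R, F x]]) h u)%E.
Proof.
move=> mh h0.
have [mf f_ge0 _] := F_pdf.
have mFT : measurable_fun [set: measurableTypeR R]
    (F : measurableTypeR R -> measurableTypeR R).
  exact: continuous_measurable_fun.
have mhT : measurable_fun [set: measurableTypeR R] h := mh.
have mitv (i : interval R) : measurable [set` i] := measurable_itv i.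
pose f1 := f \_ [set` `]-oo, x]].
have f1_ge0 y : 0 <= f1 y by rewrite /f1 patchE; case: ifP.
have intf1 : mu.-integrable [set: R] (EFin \o f1).
  rewrite /f1 -restrict_EFin.
  apply: (@integrable_restrict _ _ R mu _ (mitv `]-oo, x]) setT measurableT
    (EFin \o f)).1.
  rewrite setTI; apply: (integrableS measurableT _ _ (pdf_integrable F_df F_pdf)).
    exact: mitv.
  exact: subsetT.
pose f2 : R -> R := \1_[set` `[0, F x]].
have f2_ge0 y : 0 <= f2 y by rewrite /f2 indicE.
have intf2 : mu.-integrable [set: R] (EFin \o f2).
  exact: integrable_indic_itv.
have mnu1 b : density_measure intf1 f1_ge0 (F @^-1` [set` `]-oo, b]]) =
    density_measure intf2 f2_ge0 [set` `]-oo, b]].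
  rewrite /density_measure integral_indic; [|exact: mitv..].
  have -> : (\int[mu]_(y in F @^-1` [set` `]-oo, b]]) (f1 y)%:E =
      \int[mu]_(y in [set` `]-oo, x]] `&` [set y | (F y <= b)%R]) (f y)%:E)%E.
    rewrite setIC integral_mkcondr preimage_itvNyc.
    by apply: eq_integral => y _; rewrite /f1 !patchE; case: ifPn.
  have [b0|b0] := leP 0 b; last first.
    have -> : [set y | F y <= b] = set0.
      rewrite -subset0 => y /=.
      by rewrite leNgt (lt_le_trans b0 (df_ge0 F_df y)).
    rewrite setI0 integral_set0 (_ : _ `&` _ = set0) ?measure0//.
    rewrite -subset0 => y [] /=; rewrite !in_itv/= => /andP[y0 _].
    by rewrite leNgt (lt_le_trans b0 y0).
  rewrite (pdf_sublevel _ b0).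
  have -> : [set` `[0, F x]] `&` [set` `]-oo, b]] = [set` `[0, Num.min (F x) b]].
    apply/seteqP; split => y /=; rewrite !in_itv/= le_min.
      by move=> [/andP[-> ->] ->].
    by move=> /andP[-> /andP[-> ->]].
  rewrite [RHS]lebesgue_measure_itv/= lte_fin sube0.
  case: ltP => // min0; congr (_%:E); apply/eqP.
  by rewrite eq_le min0 le_min df_ge0.
transitivity (\int[mu]_y (h (F y) * (f1 y)%:E))%E.
  rewrite integral_mkcond; apply: eq_integral => y _.
  by rewrite /f1 !patchE; case: ifPn => // _; rewrite mule0.
rewrite -(@ge0_integral_density _ _ _ mu f1 intf1 f1_ge0 (h \o F))//; last first.
- exact/measurable_funTS/measurableT_comp.
- by move=> y; exact: h0.
pose nu1 : {measure set (measurableTypeR R) -> \bar R} :=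
  density_measure intf1 f1_ge0.
pose nu2 : {measure set (measurableTypeR R) -> \bar R} :=
  density_measure intf2 f2_ge0.
have := @ge0_integral_pushforward _ _ _ (measurableTypeR R) _ _ mFT nu1 setT h
  measurableT mhT (fun u _ => h0 u).
rewrite preimage_setT => <-.
transitivity (\int[nu2]_y h y)%E.
  apply: eq_measure_integral => A mA _.
  have nu_lty g (ig : mu.-integrable [set: R] (EFin \o g)) g0 :
      (density_measure ig g0 [set: R] < +oo)%E.
    by rewrite ltey_eq fin_num_measure//; exact: measurableT.
  by apply: measure_unique_itvNyc => //=; rewrite /pushforward ?preimage_setT.
rewrite (@ge0_integral_density _ _ _ mu f2 intf2 f2_ge0)//.
rewrite [RHS]integral_mkcond; apply: eq_integral => u _.
rewrite /f2 patchE indicE; case: ifPn => _; first by rewrite mule1.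
by rewrite mule0.
Qed.

End probability_integral_transform.

(** * Mixtures of Erlang tails *)

(* Extended by 0 on [u <= 0] and by 1 on [1 <= u], so as to be continuous and
   nondecreasing on the whole line; the cut-off matters because [ln u = 0] for
   [u <= 0]. *)
Definition erlang_tail_log {R : realType} (k : nat) (t u : R) : R :=
  if u <= 0 then 0 else erlang_tail k (t * - ln (Num.min u 1)).

Section erlang_tail_log.
Context {R : realType} (k : nat) (t : R).
Hypotheses (k_gt0 : (0 < k)%N) (t_gt0 : 0 < t).
Local Notation K := (erlang_tail_log k t).

Let L_ge0 (u : R) : 0 <= t * - ln (Num.min u 1).
Proof. by rewrite mulr_ge0 ?(ltW t_gt0)// oppr_ge0 ln_le0// ge_min lexx orbT. Qed.

Lemma erlang_tail_log_ge0 (u : R) : 0 <= K u.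
Proof. by rewrite /erlang_tail_log; case: ifP => // _; rewrite erlang_tail_ge0. Qed.

Lemma erlang_tail_log_le1 (u : R) : K u <= 1.
Proof. by rewrite /erlang_tail_log; case: ifP => // _; rewrite erlang_tail_le1. Qed.

Lemma erlang_tail_log_eq0 (u : R) : u <= 0 -> K u = 0.
Proof. by rewrite /erlang_tail_log => ->. Qed.

Lemma erlang_tail_logE (u : R) : 0 < u -> u <= 1 -> K u = erlang_tail k (t * - ln u).
Proof.
by move=> u0 u1; rewrite /erlang_tail_log leNgt u0/= min_l.
Qed.

Lemma erlang_tail_log_eq1 (u : R) : 1 <= u -> K u = 1.
Proof.
move=> u1; rewrite /erlang_tail_log leNgt (lt_le_trans ltr01 u1)/= min_r//.
by rewrite ln1 oppr0 mulr0 -(prednK k_gt0) erlang_tail0.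
Qed.

Lemma erlang_tail_log_lt1 (u : R) : u < 1 -> K u < 1.
Proof.
move=> u1; have [u0|u0] := leP u 0; first by rewrite erlang_tail_log_eq0.
rewrite erlang_tail_logE ?(ltW u1)// erlang_tail_lt1// mulr_gt0// oppr_gt0.
by rewrite ln_lt0// u0.
Qed.

Lemma erlang_tail_log_nd (u v : R) : u <= v -> K u <= K v.
Proof.
move=> uv; have [u0|u0] := leP u 0.
  by rewrite erlang_tail_log_eq0// erlang_tail_log_ge0.
rewrite /erlang_tail_log (leNgt u) (leNgt v) u0 (lt_le_trans u0 uv)/=.
apply: erlang_tail_nincr => //; rewrite ler_pM2l// lerN2 ler_ln.
- by rewrite le_min !ge_min uv lexx orbT.
- by rewrite posrE lt_min u0 ltr01.
- by rewrite posrE lt_min (lt_le_trans u0 uv) ltr01.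
Qed.

Let cont_gt0 (u : R) : 0 < u -> {for u, continuous K}.
Proof.
move=> u0.
have cK : {for u, continuous (fun v : R => erlang_tail k (t * - ln (Num.min v 1)))}.
  apply: (@continuous_comp _ _ _ (fun v : R => t * - ln (Num.min v 1)) (erlang_tail k)).
    apply: cvgM; first exact: cvg_cst.
    apply: cvgN; apply: (@continuous_comp _ _ _ (fun v : R => Num.min v 1) (@ln R)).
      by apply: continuous_min; [exact: cvg_id|exact: cvg_cst].
    by apply: continuous_ln; rewrite lt_min u0 ltr01.
  exact: continuous_erlang_tail.
rewrite /prop_for /continuous_at {2}/erlang_tail_log leNgt u0/=.
apply: cvg_trans cK; apply: near_eq_cvg; near=> v.
rewrite /erlang_tail_log leNgt (_ : 0 < v)//.
by near: v; exact: lt_nbhsr.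
Unshelve. all: by end_near. Qed.

(** By monotonicity it suffices to find one positive point where [K] is below [e]. At
    [expR (- (y / t))] the Erlang argument is [y], and [erlang_tail_decay] bounds the value by
    [C / y]; the choice of [y] makes this strictly less than [e]. *)
Let cont_0 : {for 0, continuous K}.
Proof.
apply/cvgrPdist_lt => e e0; rewrite (erlang_tail_log_eq0 (lexx 0)).
pose C : R := \sum_(i < k) i.+1%:R.
have C0 : 0 <= C by apply: sumr_ge0 => i _; rewrite ler0n.
pose y := (C + 1) / e.
have y0 : 0 < y by rewrite divr_gt0// ltr_wpDl.
have Ke : K (expR (- (y / t))) < e.
  rewrite erlang_tail_logE ?expR_gt0//; last first.
    by rewrite -expR0 ler_expR oppr_le0 divr_ge0// ltW.
  rewrite expRK opprK mulrC divfK ?gt_eqF//.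
  have := erlang_tail_decay k (ltW y0).
  rewrite -ler_pdivlMl// => /le_lt_trans; apply.
  rewrite ltr_pdivrMl// /y divfK ?gt_eqF// -/C.
  by rewrite ltrDl.
near=> v; rewrite sub0r normrN ger0_norm ?erlang_tail_log_ge0//.
apply: (le_lt_trans _ Ke); apply: erlang_tail_log_nd.
by apply/ltW; near: v; apply: lt_nbhsl; exact: expR_gt0.
Unshelve. all: by end_near. Qed.

Lemma continuous_erlang_tail_log : continuous K.
Proof.
move=> u; have [u0|/cont_gt0//|->] := ltgtP u 0; last exact: cont_0.
rewrite /continuous_at (erlang_tail_log_eq0 (ltW u0)).
apply: cvg_near_cst; near=> v; apply/eqP.
rewrite erlang_tail_log_eq0//.
by near: v; exact: lt_le_nbhsl.
Unshelve. all: by end_near. Qed.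

End erlang_tail_log.

(* The value on [y <= 0] is the limit at 0 from the right. *)
Definition erlang_cdf_ratio {R : realType} (k : nat) (y : R) : R :=
  if y <= 0 then k`!%:R^-1 else (1 - erlang_tail k y) / y ^+ k.

Section erlang_cdf_ratio.
Context {R : realType} (k : nat).
Implicit Types y : R.
Local Notation r := (@erlang_cdf_ratio R k).

Lemma erlang_cdf_ratioE y : 0 < y -> 1 - erlang_tail k y = y ^+ k * r y.
Proof.
move=> y0; rewrite /erlang_cdf_ratio leNgt y0/= mulrC divfK//.
by rewrite expf_neq0// gt_eqF.
Qed.

Lemma erlang_cdf_ratio0 : r 0 = k`!%:R^-1.
Proof. by rewrite /erlang_cdf_ratio lexx. Qed.

Lemma erlang_cdf_ratio_ge y : 0 < y -> expR (- y) / k`!%:R <= r y.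
Proof.
move=> y0; rewrite /erlang_cdf_ratio (leNgt y) y0/= ler_pdivlMr ?exprn_gt0//.
by rewrite -mulrA [_^-1 * _]mulrC (poisson_weight_le _ (ltW y0)).
Qed.

Lemma erlang_cdf_ratio_le y : r y <= k`!%:R^-1.
Proof.
rewrite /erlang_cdf_ratio; have [y0|y0] := leP y 0; first by rewrite ?invr_ge0.
by rewrite ler_pdivrMr ?exprn_gt0// mulrC (onem_erlang_tail_le _ (ltW y0)).
Qed.

Lemma erlang_cdf_ratio_ge0 y : 0 <= r y.
Proof.
rewrite /erlang_cdf_ratio; have [y0|y0] := leP y 0; first by rewrite ?invr_ge0.
by rewrite divr_ge0 ?exprn_ge0 ?(ltW y0)// subr_ge0 erlang_tail_le1// ltW.
Qed.

Lemma continuous_erlang_cdf_ratio : continuous r.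
Proof.
move=> y; have [y0|y0|->] := ltgtP y 0.
- rewrite /continuous_at {2}/erlang_cdf_ratio (ltW y0).
  apply: cvg_near_cst; near=> z; apply/eqP.
  rewrite /erlang_cdf_ratio ifT//.
  by near: z; exact: lt_le_nbhsl.
- have c : {for y, continuous (fun z : R => (1 - erlang_tail k z) / z ^+ k)}.
    apply: cvgM; first by apply: cvgB; [exact: cvg_cst|exact: continuous_erlang_tail].
    apply: cvgV; first by rewrite expf_neq0// gt_eqF.
    exact: exprn_continuous.
  rewrite /continuous_at {2}/erlang_cdf_ratio leNgt y0/=.
  apply: cvg_trans c; apply: near_eq_cvg; near=> z.
  rewrite /erlang_cdf_ratio leNgt (_ : 0 < z)//.
  by near: z; exact: lt_nbhsr.
- rewrite /continuous_at erlang_cdf_ratio0.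
  (* The absolute value makes one lower bound valid on both sides of 0, so a single squeeze
     suffices. *)
  have c : (fun z : R => expR (- `|z|) / k`!%:R) @ 0 --> (k`!%:R^-1 : R).
    rewrite -[X in _ --> X]mul1r; apply: cvgM; last exact: cvg_cst.
    have n0 : (fun z : R => - `|z|) @ 0 --> (0 : R).
      have := cvgN (@norm_continuous _ R 0); rewrite normr0 oppr0; exact.
    rewrite -(@expR0 R).
    exact: cvg_comp n0 (@continuous_expR R 0).
  apply: squeeze_cvgr c (cvg_cst _).
  near=> z; rewrite erlang_cdf_ratio_le andbT.
  have [z0|z0] := leP z 0.
    by rewrite /erlang_cdf_ratio z0 ler_piMl ?invr_ge0//.
  by rewrite gtr0_norm// erlang_cdf_ratio_ge.
Unshelve. all: by end_near. Qed.

End erlang_cdf_ratio.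

(** This is [poisson_weight i (t * a) <= 1] rearranged; the bound is uniform in [t], which makes the
    moments in [Bk] and [bk] finite. *)
Lemma exprn_expRN_le {R : realType} (i : nat) (a t : R) : 0 < a -> 0 <= t ->
  t ^+ i * expR (- (t * a)) <= i`!%:R / a ^+ i.
Proof.
move=> a0 t0; rewrite ler_pdivlMr ?exprn_gt0// mulrAC -exprMn.
have := poisson_weight_le1 i (mulr_ge0 t0 (ltW a0)).
by rewrite /poisson_weight mulrA ler_pdivrMr ?ltr0n ?fact_gt0// mul1r mulrC.
Qed.

Section mixture.
Context d (T : measurableType d) (R : realType) (P : probability T R).
Variable tau : {RV P >-> R}.
Hypothesis tau_gt0 : forall w, 0 < tau w.

Definition mixture_df (k : nat) (u : R) : R :=
  (\int[P]_w erlang_tail_log k (tau w) u)%R.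

Lemma integrable_bounded (g : T -> R) (M : R) : measurable_fun [set: T] g ->
  (forall w, `|g w| <= M) -> P.-integrable [set: T] (EFin \o g).
Proof.
move=> mg gM.
apply: (@le_integrable _ _ _ P _ measurableT _ (EFin \o cst M)).
- exact/measurable_EFinP.
- by move=> w _ /=; rewrite lee_fin (le_trans (gM w))// ler_norm.
- exact: finite_measure_integrable_cst.
Qed.

(** A zero integral would make [h] vanish almost everywhere, so the whole space would be null,
    against [P [set: T] = 1]. *)
Lemma probability_integral_gt0 (h : T -> \bar R) :
  measurable_fun [set: T] h -> (forall w, 0 < h w)%E -> (0 < \int[P]_w h w)%E.
Proof.
move=> mh h_gt0.
rewrite lt0e; apply/andP; split; last by apply: integral_ge0 => w _; exact: ltW.
apply/eqP => i0.
have [+ _] := @ae_eq_integral_abs _ _ _ P _ measurableT _ mh.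
case; first by under eq_integral do rewrite gee0_abs ?(ltW (h_gt0 _))//.
move=> N [mN N0 subN].
have : P [set: T] = 0%E.
  apply/eqP; rewrite eq_le measure_ge0 andbT -N0; apply: le_measure; rewrite ?inE//.
  by move=> w _; apply: subN => /= /(_ I) h0; have := h_gt0 w; rewrite h0 ltxx.
by rewrite probability_setT => /eqP; rewrite onee_eq0.
Qed.

Let mtau : measurable_fun [set: T] tau := measurable_funPT tau.

Let integral_P1 : (\int[P]_w (1%:E : \bar R) = 1)%E.
Proof. rewrite integral_cst// mul1e; exact: probability_setT. Qed.

Lemma measurable_erlang_tail_log k u :
  measurable_fun [set: T] (fun w => erlang_tail_log k (tau w) u).
Proof.
rewrite /erlang_tail_log; case: (u <= 0); first exact: measurable_cst.
apply: (@measurableT_comp _ _ _ _ _ _ (erlang_tail k)).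
  exact: continuous_measurable_fun (@continuous_erlang_tail R k).
exact: measurable_funM.
Qed.

Lemma integrable_erlang_tail_log k u :
  P.-integrable [set: T] (fun w => (erlang_tail_log k (tau w) u)%:E).
Proof.
apply: (@integrable_bounded _ 1); first exact: measurable_erlang_tail_log.
by move=> w; rewrite ger0_norm ?erlang_tail_log_ge0 ?erlang_tail_log_le1.
Qed.

Lemma mixture_dfE k u :
  ((mixture_df k u)%:E = \int[P]_w (erlang_tail_log k (tau w) u)%:E)%E.
Proof.
rewrite /mixture_df /Rintegral fineK//.
exact: integrable_fin_num (integrable_erlang_tail_log k u).
Qed.

Lemma mixture_df_eq0 k u : u <= 0 -> mixture_df k u = 0.
Proof.
move=> u0; apply/EFin_inj; rewrite mixture_dfE.
under eq_integral do rewrite erlang_tail_log_eq0//.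
exact: integral0.
Qed.

Lemma mixture_df_eq1 k u : (0 < k)%N -> 1 <= u -> mixture_df k u = 1.
Proof.
move=> k0 u1; apply/EFin_inj; rewrite mixture_dfE.
under eq_integral do rewrite erlang_tail_log_eq1//.
exact: integral_P1.
Qed.

Lemma mixture_df_nd k : {homo mixture_df k : u v / u <= v}.
Proof.
move=> u v uv; rewrite -lee_fin !mixture_dfE; apply: ge0_le_integral => //.
- by move=> w _; rewrite lee_fin erlang_tail_log_ge0.
- exact/measurable_EFinP/measurable_erlang_tail_log.
- exact/measurable_EFinP/measurable_erlang_tail_log.
- by move=> w _; rewrite lee_fin erlang_tail_log_nd.
Qed.

Lemma onem_mixture_df k u : (1 - mixture_df k u)%:E =
  (\int[P]_w (1 - erlang_tail_log k (tau w) u)%:E)%E.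
Proof.
under eq_integral do rewrite EFinB.
rewrite integralB//; last 2 first.
- exact: finite_measure_integrable_cst.
- exact: integrable_erlang_tail_log.
by rewrite -mixture_dfE integral_P1.
Qed.

Lemma mixture_df_lt1 k u : u < 1 -> mixture_df k u < 1.
Proof.
move=> u1; rewrite -subr_gt0 -lte_fin onem_mixture_df.
apply: probability_integral_gt0 => [|w].
  apply/measurable_EFinP; apply: measurable_funB => //.
  exact: measurable_erlang_tail_log.
by rewrite lte_fin subr_gt0 erlang_tail_log_lt1.
Qed.

(** Dominated convergence: the kernel is continuous in [u] and bounded by the integrable constant
    1. *)
Lemma continuous_mixture_df k : (0 < k)%N -> continuous (mixture_df k).
Proof.
move=> k0 u.
have := @continuity_under_integral R _ T P
  (fun u w => erlang_tail_log k (tau w) u) setT measurableT (u - 1) (u + 1).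
apply.
- by move=> v _; exact: integrable_erlang_tail_log.
- by apply: aeW => w _ v _; exact: continuous_erlang_tail_log.
- exact: (finite_measure_integrable_cst P 1).
- move=> v _; apply: aeW => w _.
  by rewrite ger0_norm ?erlang_tail_log_ge0 ?erlang_tail_log_le1.
- rewrite inE/= in_itv/=; apply/andP; split; lra.
Qed.

End mixture.

(** The index is shifted: this is the derivative in [u] of the kernel of order [k.+1] on (0, 1). *)
Definition erlang_tail_log_derivative {R : realType} (k : nat) (t u : R) : R :=
  (- ln u) ^+ k / k`!%:R * (t ^+ k.+1 * u `^ (t - 1)).

Section fundamental_theorem.
Context {R : realType} (k : nat) (t : R).
Hypothesis t_gt0 : 0 < t.
Local Notation mu := (@lebesgue_measure R).
Local Notation K := (fun u : R => erlang_tail k.+1 (t * - ln u)).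
Local Notation g := (erlang_tail_log_derivative k t).

Lemma is_derive_erlang_tail_log (u : R) : 0 < u -> is_derive u 1 K (g u).
Proof.
move=> u0.
have dl : is_derive u 1 (fun v : R => t * - ln v) (- t / u).
  have h := is_derive1_ln u0.
  have -> : (fun v : R => t * - ln v) = (- t) \*: (@ln R).
    by apply/funext => v /=; rewrite /GRing.scale/= mulrN mulNr.
  exact: is_deriveZ.
have h := @is_derive1_comp R (erlang_tail k.+1) (fun v : R => t * - ln v) u _ _
  (is_derive_erlang_tail k (t * - ln u)) dl.
apply: (is_derive_eq h).
rewrite /erlang_tail_log_derivative /poisson_weight /powR gt_eqF//.
have -> : expR ((t - 1) * ln u) = expR (t * ln u) / u.
  by rewrite mulrBl mul1r expRD expRN lnK.
rewrite mulrN opprK exprS -mulrN exprMn.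
have := factr_neq0 (R := R) k; have : u != 0 by rewrite gt_eqF.
by move=> ? ?; field; apply/andP.
Qed.

Lemma continuous_erlang_tail_log_derivative (u : R) : 0 < u -> {for u, continuous g}.
Proof.
move=> u0; apply: cvgM.
  apply: cvgM; last exact: cvg_cst.
  apply: (@continuous_comp _ _ _ (fun v : R => - ln v) (fun v => v ^+ k)).
    by apply: cvgN; exact: continuous_ln.
  exact: exprn_continuous.
apply: cvgM; first exact: cvg_cst.
have /derivable1_diffP/differentiable_continuous c :
    derivable (@powR R ^~ (t - 1)) u 1.
  by apply: derivable_powR; rewrite in_itv/= u0.
exact: c.
Qed.

Lemma erlang_tail_log_derivative_ge0 u : 0 < u -> u <= 1 -> 0 <= g u.
Proof.
move=> u0 u1; rewrite /erlang_tail_log_derivative.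
rewrite mulr_ge0// ?divr_ge0 ?exprn_ge0 ?oppr_ge0 ?ln_le0//.
by rewrite mulr_ge0 ?powR_ge0 ?exprn_ge0 ?(ltW t_gt0).
Qed.

Lemma measurable_erlang_tail_log_derivative : measurable_fun [set: R] g.
Proof.
apply: measurable_funM; apply: measurable_funM => //.
  apply: measurable_funX; apply: measurableT_comp => //; exact: measurable_ln.
Qed.

(** The derivative can blow up at 0, for instance when [t < 1]. The fundamental theorem is therefore
    applied on [[a n, v]], and [a n] tends to 0: monotone convergence handles the integrals,
    continuity of the extended kernel at 0 the boundary term. *)
Lemma integral_erlang_tail_log_derivative (v : R) : 0 < v -> v <= 1 ->
  (\int[mu]_(u in [set` `[0%R, v]]) (g u)%:E = (erlang_tail_log k.+1 t v)%:E)%E.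
Proof.
move=> v0 v1.
have mE : measurable_fun [set: R] (EFin \o g).
  by apply/measurable_EFinP; apply: measurable_erlang_tail_log_derivative.
rewrite -integral_itv_obnd_cbnd; last exact: measurable_funTS mE.
(* With [n.+2] the point [a n] lies strictly below [v] already for [n = 0]. *)
pose a n : R := v / n.+2%:R.
have a_gt0 n : 0 < a n by rewrite divr_gt0.
have a_lt n : a n < v by rewrite ltr_pdivrMr// ltr_pMr// ltr1n.
have a_cvg : a @ \oo --> (0 : R).
  rewrite -(mulr0 v); apply: cvgM; first exact: cvg_cst.
  have := @cvg_harmonic R; rewrite -cvg_shiftS; exact.
pose I n := `[a n, v]%classic.
have IE : [set` `]0, v]] = \bigcup_n I n.
  apply/seteqP; split => u /=; rewrite /I/= in_itv/=.
    move=> /andP[u0 uv]; exists (Num.bound (v / u)) => //=.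
    rewrite in_itv/= uv andbT /a ler_pdivrMr// mulrC -ler_pdivrMr// ltW//.
    rewrite (lt_trans (archi_boundP _)) ?divr_ge0 ?ltW//.
    by rewrite ltr_nat.
  move=> [n _] /=; rewrite in_itv/= => /andP[au ->].
  by rewrite (lt_le_trans (a_gt0 n) au).
have intI n : (\int[mu]_(u in I n) (g u)%:E =
    (erlang_tail_log k.+1 t v)%:E - (erlang_tail_log k.+1 t (a n))%:E)%E.
  rewrite !erlang_tail_logE//; last exact: le_trans (ltW (a_lt n)) v1.
  apply: (@continuous_FTC2 _ g K) => //.
  - apply: continuous_in_subspaceT => u; rewrite inE/= in_itv/= => /andP[au _].
    by apply: continuous_erlang_tail_log_derivative; exact: lt_le_trans au.
  - have cK u : 0 < u -> {for u, continuous K}.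
      move=> u0; apply: differentiable_continuous; apply/derivable1_diffP.
      by have [] := is_derive_erlang_tail_log u0.
    split.
    + move=> u; rewrite in_itv/= => /andP[au _].
      by have [] := is_derive_erlang_tail_log (lt_trans (a_gt0 n) au).
    + by apply: cvg_at_right_filter; exact: cK.
    + by apply: cvg_at_left_filter; exact: cK.
  - move=> u; rewrite in_itv/= => /andP[au _].
    have dK := is_derive_erlang_tail_log (lt_trans (a_gt0 n) au).
    by rewrite derive1E (@derive_val _ _ _ _ _ _ _ dK).
have c1 : (\int[mu]_(u in I n) (g u)%:E)%E @[n --> \oo] -->
    (\int[mu]_(u in [set` `]0%R, v]]) (g u)%:E)%E.
  rewrite IE; apply: ge0_nondecreasing_set_cvg_integral => //.
  - move=> m n mn; apply/subsetPset/subset_itvr; rewrite bnd_simp.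
    by rewrite /a ler_pM2l// lef_pV2 ?posrE// ler_nat !ltnS.
  - by move=> n; exact: measurable_itv.
  - by move=> n; exact: measurable_funTS mE.
  - move=> n u; rewrite /I/= in_itv/= => /andP[au uv]; rewrite lee_fin.
    apply: erlang_tail_log_derivative_ge0; first exact: lt_le_trans au.
    exact: le_trans v1.
have c2 : (\int[mu]_(u in I n) (g u)%:E)%E @[n --> \oo] -->
    (erlang_tail_log k.+1 t v)%:E.
  under eq_fun do rewrite intI -EFinB.
  apply: cvg_EFin; first by near=> n.
  rewrite -[X in _ --> X]subr0; apply: cvgB; first exact: cvg_cst.
  rewrite -(@erlang_tail_log_eq0 _ k.+1 t 0)//.
  apply: cvg_comp a_cvg _; exact: continuous_erlang_tail_log.
exact: cvg_unique c1 c2.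
Unshelve. all: by end_near. Qed.

End fundamental_theorem.

Lemma exprn_powR_le {R : realType} (i : nat) (t u : R) : 0 < t -> 0 < u -> u < 1 ->
  t ^+ i * u `^ t <= i`!%:R / (- ln u) ^+ i.
Proof.
move=> t0 u0 u1; rewrite /powR gt_eqF//.
have -> : t * ln u = - (t * - ln u) by rewrite mulrN opprK.
apply: exprn_expRN_le; rewrite ?(ltW t0)// oppr_gt0 ln_lt0// u0//.
Qed.

Lemma powRB1 {R : realType} (t u : R) : 0 < u -> u `^ (t - 1) = u^-1 * u `^ t.
Proof.
move=> u0; rewrite powRB; last by rewrite (gt_eqF u0) implybT.
by rewrite powRr1 ?(ltW u0)// mulrC.
Qed.

Section mixture_density.
Context d (T : measurableType d) (R : realType) (P : probability T R).
Variable tau : {RV P >-> R}.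
Hypothesis tau_gt0 : forall w, 0 < tau w.
Local Notation mu := (@lebesgue_measure R).

Let mtau : measurable_fun [set: T] tau := measurable_funPT tau.

Definition mixture_density (k : nat) (u : R) : R :=
  (- ln u) ^+ k.-1 / (k.-1`!)%:R *
    fine 'E_P[(fun w => tau w ^+ k * u `^ (tau w - 1))%R]%E.

Lemma measurable_moment (i : nat) (u : R) :
  measurable_fun [set: T] (fun w => tau w ^+ i * u `^ tau w).
Proof.
apply: measurable_funM; first exact: measurable_funX.
by apply: measurableT_comp => //; exact: measurable_powRr.
Qed.

Lemma moment_fin_num (i : nat) (u : R) : 0 < u -> u < 1 ->
  (\int[P]_w (tau w ^+ i * u `^ tau w)%:E)%E \is a fin_num.
Proof.
move=> u0 u1.
apply: integrable_fin_num => //.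
apply: (@integrable_bounded _ _ _ P _ (i`!%:R / (- ln u) ^+ i)).
  exact: measurable_moment.
move=> w; rewrite ger0_norm; last first.
  by rewrite mulr_ge0 ?powR_ge0 ?exprn_ge0 ?(ltW (tau_gt0 w)).
exact: exprn_powR_le.
Qed.

Lemma measurable_powR_tau :
  measurable_fun [set: R * T] (fun p : R * T => p.1 `^ (tau p.2 - 1)).
Proof.
have m2 : measurable_fun [set: R * T] (fun p : R * T => tau p.2 - 1).
  apply: measurable_funB => //; apply: measurableT_comp => //.
(* [powR] unfolds to a case split on whether the base is 0: there it is the indicator of a zero
   exponent, elsewhere an exponential of a product. *)
apply: measurable_fun_ifT.
- by apply: measurable_fun_eqr.
- rewrite (_ : (fun p : R * T => _) =
    fun p : R * T => if tau p.2 - 1 == 0 then 1 else 0).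
    by apply: measurable_fun_ifT => //; exact: measurable_fun_eqr.
  by apply/funext => p; case: eqP.
- apply: measurableT_comp => //; apply: measurable_funM => //.
  by apply: measurableT_comp => //; exact: measurable_ln.
Qed.

Lemma measurable_mixture_density k : measurable_fun [set: R] (mixture_density k).
Proof.
apply: measurable_funM.
  apply: measurable_funM => //; apply: measurable_funX.
  by apply: measurableT_comp => //; exact: measurable_ln.
rewrite unlock.
have m : measurable_fun [set: R * T]
    (fun p : R * T => (tau p.2 ^+ k * p.1 `^ (tau p.2 - 1))%:E).
  apply/measurable_EFinP; apply: measurable_funM; last exact: measurable_powR_tau.
  by apply: measurable_funX; apply: measurableT_comp.
have := @measurable_fun_fubini_tonelli_F _ _ _ _ R P _ m.
move=> h.
apply: (measurableT_comp (f := @fine R)).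
  exact: fine_measurable.
apply: h.
by move=> p; rewrite lee_fin mulr_ge0 ?powR_ge0 ?exprn_ge0 ?(ltW (tau_gt0 _)).
Qed.

(** Once [u^-1] is pulled out, the remaining moment is finite by [moment_fin_num], so [fine] can be
    removed and all factors returned under the integral. *)
Lemma mixture_densityE (k : nat) (u : R) : 0 < u -> u < 1 ->
  ((mixture_density k.+1 u)%:E =
   \int[P]_w (erlang_tail_log_derivative k (tau w) u)%:E)%E.
Proof.
move=> u0 u1; rewrite /mixture_density unlock /=.
rewrite [X in fine X](_ : _ =
    (u^-1)%:E * \int[P]_w (tau w ^+ k.+1 * u `^ tau w)%:E)%E; last first.
  under eq_integral do rewrite (powRB1 _ u0) mulrCA EFinM.
  rewrite -ge0_integralZl_EFin ?invr_ge0 ?ltW//.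
  - by move=> w _; rewrite lee_fin mulr_ge0 ?powR_ge0 ?exprn_ge0 ?(ltW (tau_gt0 _)).
  - by apply/measurable_EFinP; exact: measurable_moment.
rewrite EFinM fineK; last by rewrite fin_numM// moment_fin_num.
have mM : measurable_fun [set: T] (fun w => (tau w ^+ k.+1 * u `^ tau w)%:E).
  by apply/measurable_EFinP; exact: measurable_moment.
have M0 w : (0 <= (tau w ^+ k.+1 * u `^ tau w)%:E)%E.
  by rewrite lee_fin mulr_ge0 ?powR_ge0 ?exprn_ge0 ?(ltW (tau_gt0 _)).
rewrite muleA -EFinM -ge0_integralZl_EFin//; last first.
  rewrite mulr_ge0 ?invr_ge0 ?(ltW u0)// divr_ge0// exprn_ge0// oppr_ge0.
  by rewrite ln_le0// ltW.
apply: eq_integral => w _; rewrite -EFinM; congr (_%:E).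
by rewrite /erlang_tail_log_derivative (powRB1 _ u0) (mulrCA (tau w ^+ _)) [RHS]mulrA.
Qed.

(* The absolute value makes the integrand nonnegative on the whole line, as
   [ge0_integral_df_comp] wants; [mixture_density] is nonnegative on [0, 1]. *)
Lemma integral_mixture_density (k : nat) (v : R) : 0 <= v -> v <= 1 ->
  (\int[mu]_(u in [set` `[0%R, v]]) `|mixture_density k.+1 u|%:E =
   (mixture_df tau k.+1 v)%:E)%E.
Proof.
rewrite le_eqVlt => /predU1P[<- _|v0 v1].
  by rewrite set_itv1 integral_set1 mixture_df_eq0.
have mabs : measurable_fun [set: R] (fun u => `|mixture_density k.+1 u|%:E).
  apply/measurable_EFinP; apply: measurableT_comp => //.
  exact: measurable_mixture_density.
(* Both endpoints are dropped because [mixture_densityE] requires [0 < u < 1], while [v] may be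
   1. *)
rewrite -integral_itv_obnd_cbnd; last exact: measurable_funTS mabs.
rewrite -integral_itv_bndo_bndc; last exact: measurable_funTS mabs.
(* The indicator makes [G] nonnegative on the whole product, as Tonelli requires: for [u > 1] the
   kernel derivative may be negative. *)
pose G (p : R * T) :=
  (erlang_tail_log_derivative k (tau p.2) p.1 * \1_[set` `]0, v[] p.1)%:E.
have G0 p : (0 <= G p)%E.
  rewrite lee_fin indicE; have [|_] := boolP (p.1 \in _); last by rewrite mulr0.
  rewrite inE/= in_itv/= mulr1 => /andP[u0 uv].
  by apply: erlang_tail_log_derivative_ge0 => //; rewrite ltW// (lt_le_trans uv).
have mG : measurable_fun [set: R * T] G.
  apply/measurable_EFinP; apply: measurable_funM.
    apply: measurable_funM; last first.
      apply: measurable_funM; last exact: measurable_powR_tau.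
      by apply: measurable_funX; apply: measurableT_comp.
    apply: measurable_funM => //; apply: measurable_funX.
    apply: measurableT_comp => //; apply: measurableT_comp (@measurable_ln R) _ => //.
  by apply: measurableT_comp => //; exact: measurable_indic.
transitivity (\int[mu]_u \int[P]_w G (u, w))%E.
  rewrite integral_mkcond; apply: eq_integral => u _.
  rewrite patchE; case: ifPn => [|un].
    rewrite inE/= in_itv/= => /andP[u0 uv].
    have u1 := lt_le_trans uv v1.
    have -> : (`|mixture_density k.+1 u|%:E = (mixture_density k.+1 u)%:E)%E.
      rewrite ger0_norm// -lee_fin mixture_densityE//; apply: integral_ge0 => w _.
      by rewrite lee_fin erlang_tail_log_derivative_ge0// ltW.
    rewrite mixture_densityE//; apply: eq_integral => w _.
    by rewrite /G/= indicE mem_set ?mulr1//= in_itv/= u0.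
  by apply/esym; apply: integral0_eq => w _; rewrite /G/= indicE (negbTE un) mulr0.
transitivity (\int[P]_w \int[mu]_u G (u, w))%E.
  exact: (@fubini_tonelli _ _ (measurableTypeR R) T R lebesgue_measure P G mG G0).
rewrite (mixture_dfE tau_gt0); apply: eq_integral => w _.
rewrite -integral_erlang_tail_log_derivative//.
have mE : measurable_fun [set: R] (EFin \o erlang_tail_log_derivative k (tau w)).
  by apply/measurable_EFinP; apply: measurable_erlang_tail_log_derivative.
rewrite -integral_itv_obnd_cbnd; last exact: measurable_funTS mE.
rewrite -integral_itv_bndo_bndc; last exact: measurable_funTS mE.
rewrite [RHS]integral_mkcond; apply: eq_integral => u _.
by rewrite /G/= patchE indicE; case: ifPn => _; rewrite ?mulr1 ?mulr0.
Qed.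

End mixture_density.

(** * Tail behaviour *)

(** The ratio lies between 1 and [u^-1], by the inequality ln (1 + x) <= x at [u - 1] and at
    [u^-1 - 1]. *)
Lemma cvg_ln_ratio (R : realType) : - ln u / (1 - u) @[u --> (1 : R)^'-] --> (1 : R).
Proof.
have c : u^-1 @[u --> (1 : R)^'-] --> (1 : R).
  rewrite -[X in _ --> X]invr1; apply: cvgV; first by rewrite oner_eq0.
  by apply: cvg_at_left_filter; exact: cvg_id.
apply: squeeze_cvgr (cvg_cst _) c; near=> u.
have u1 : u < 1 by near: u; exact: nbhs_left_lt.
have u0 : 0 < u by near: u; apply: nbhs_left_gt; exact: ltr01.
have d0 : 0 < 1 - u by rewrite subr_gt0.
rewrite ler_pdivlMr// ler_pdivrMr// mul1r mulrBr mulr1 mulVf ?gt_eqF//.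
rewrite -lnV ?posrE//; apply/andP; split.
  rewrite lnV ?posrE// lerNr opprB.
  have := @le_ln1Dx R (u - 1); rewrite [1 + _]addrC subrK; apply.
  by rewrite ltrBrDl subrr.
have := @le_ln1Dx R (u^-1 - 1); rewrite [1 + _]addrC subrK; apply.
by rewrite ltrBrDl subrr invr_gt0.
Unshelve. all: by end_near. Qed.

Section tail.
Context d (T : measurableType d) (R : realType) (P : probability T R).
Variable tau : {RV P >-> R}.
Hypothesis tau_gt0 : forall w, 0 < tau w.
Variable k : nat.
Hypothesis moment_lty : ('E_P[(fun w => tau w ^+ k)%R] < +oo)%E.

Let mtau : measurable_fun [set: T] tau := measurable_funPT tau.
(** For [L > 0] this is [1 - erlang_tail k (tau w * L)] divided by [L ^+ k]. Being defined at
    [L = 0] too, it turns the tail limit into continuity of its mean [Psi] at 0. *)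
Let ratio (L : R) (w : T) : R := tau w ^+ k * erlang_cdf_ratio k (tau w * L).

Let int_moment : P.-integrable [set: T] (fun w => (tau w ^+ k / k`!%:R)%:E).
Proof.
under eq_fun do rewrite mulrC EFinM.
apply: integrableZl => //; apply/integrableP; split.
  by apply/measurable_EFinP; exact: measurable_funX.
move: moment_lty; rewrite unlock; congr (_ < _)%E; apply: eq_integral => w _ /=.
by rewrite ger0_norm// exprn_ge0// ltW.
Qed.

Let ratio_le L w : `|ratio L w| <= tau w ^+ k / k`!%:R.
Proof.
rewrite ger0_norm ?mulr_ge0 ?exprn_ge0 ?erlang_cdf_ratio_ge0 ?(ltW (tau_gt0 w))//.
by rewrite ler_wpM2l ?exprn_ge0 ?(ltW (tau_gt0 w))// erlang_cdf_ratio_le.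
Qed.

Let measurable_ratio L : measurable_fun [set: T] (ratio L).
Proof.
apply: measurable_funM; first exact: measurable_funX.
apply: (@measurableT_comp _ _ _ _ _ _ (erlang_cdf_ratio k)).
  exact: continuous_measurable_fun (@continuous_erlang_cdf_ratio R k).
exact: measurable_funM.
Qed.

Let integrable_ratio L : P.-integrable [set: T] (EFin \o ratio L).
Proof.
apply: le_integrable int_moment => //.
  exact/measurable_EFinP/measurable_ratio.
move=> w _ /=; rewrite lee_fin (le_trans (ratio_le L w))// ler_norm//.
Qed.

Let Psi L := (\int[P]_w ratio L w)%R.

(** Dominated convergence; the dominating function [tau w ^+ k / k!] is integrable by the moment
    assumption. *)
Let Psi_cvg0 : Psi L @[L --> 0] --> Psi 0.
Proof.
have := @continuity_under_integral R _ T P ratio setT measurableT (-1) 1.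
move=> /(_ _ _ (fun w => tau w ^+ k / k`!%:R)); apply.
- by move=> L _; exact: integrable_ratio.
- apply: aeW => w _ L _; apply: cvgM; first exact: cvg_cst.
  apply: (@continuous_comp _ _ _ (fun L => tau w * L) (erlang_cdf_ratio k)).
    by apply: cvgM; [exact: cvg_cst|exact: cvg_id].
  exact: continuous_erlang_cdf_ratio.
- exact: int_moment.
- by move=> L _; apply: aeW => w _; exact: ratio_le.
- by rewrite inE/= in_itv/= ltrN10 ltr01.
Qed.

Let Psi_gt0 : 0 < Psi 0.
Proof.
rewrite /Psi /Rintegral fine_gt0//; apply/andP; split.
  apply: probability_integral_gt0.
    exact/measurable_EFinP/measurable_ratio.
  by move=> w; rewrite lte_fin /ratio mulr0 erlang_cdf_ratio0 mulr_gt0 ?exprn_gt0//.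
rewrite -ge0_fin_numE; first exact: integrable_fin_num (integrable_ratio 0).
apply: integral_ge0 => w _; rewrite lee_fin.
by rewrite mulr_ge0 ?exprn_ge0 ?erlang_cdf_ratio_ge0 ?(ltW (tau_gt0 w)).
Qed.

Let onem_mixture_dfE u : 0 < u -> u < 1 ->
  1 - mixture_df tau k u = (- ln u) ^+ k * Psi (- ln u).
Proof.
move=> u0 u1; apply: EFin_inj; rewrite onem_mixture_df//.
have L0 : 0 < - ln u by rewrite oppr_gt0 ln_lt0// u0.
rewrite EFinM /Psi /Rintegral fineK; last first.
  exact: integrable_fin_num (integrable_ratio _).
rewrite -integralZl//; last exact: integrable_ratio.
apply: eq_integral => w _; rewrite -EFinM; congr (_%:E).
rewrite erlang_tail_logE ?(ltW u1)// erlang_cdf_ratioE ?mulr_gt0//.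
by rewrite exprMn -mulrA mulrCA.
Qed.

Lemma cvg_onem_mixture_df : exists2 l : R, 0 < l &
  (1 - mixture_df tau k u) / (1 - u) ^+ k @[u --> (1 : R)^'-] --> l.
Proof.
exists (Psi 0); first exact: Psi_gt0.
have c1 : (- ln u / (1 - u)) ^+ k * Psi (- ln u) @[u --> (1 : R)^'-] --> Psi 0.
  rewrite -[X in _ --> X]mul1r; apply: cvgM.
    have := cvg_comp _ _ (@cvg_ln_ratio R) (@exprn_continuous _ k (1 : R)).
    by rewrite expr1n.
  have cl : - ln u @[u --> (1 : R)^'-] --> (0 : R).
    rewrite -oppr0 -(@ln1 R); apply: cvgN; apply: cvg_at_left_filter.
    by apply: continuous_ln.
  exact: (cvg_comp _ _ cl Psi_cvg0).
apply: cvg_trans c1; apply: near_eq_cvg; near=> u.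
rewrite onem_mixture_dfE; last 2 first.
- by near: u; apply: nbhs_left_gt; exact: ltr01.
- by near: u; exact: nbhs_left_lt.
by rewrite expr_div_n mulrAC.
Unshelve. all: by end_near. Qed.

End tail.

Section Bk_mixture.
Context d (T : measurableType d) (R : realType) (P : probability T R).
Variables (F f : R -> R) (tau : {RV P >-> R}).
Hypothesis tau_gt0 : forall w, 0 < tau w.

(** With [L = - ln (F x)], the power [F x] to the [tau] is [expR (- (tau * L))], and [L ^+ i] joins
    [tau ^+ i] under the mean. *)
Let fine_term (k : nat) (x : R) (i : 'I_k) : 0 < F x -> F x < 1 ->
  (((- ln (F x)) ^+ i / (i`!)%:R *
    fine 'E_P[(fun w => tau w ^+ i * F x `^ tau w)%R]%E)%:E =
   \int[P]_w (poisson_weight i (tau w * - ln (F x)))%:E)%E.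
Proof.
move=> u0 u1; rewrite unlock EFinM fineK ?moment_fin_num//.
rewrite -ge0_integralZl_EFin//.
- apply: eq_integral => w _; rewrite -EFinM; congr (_%:E).
  rewrite /poisson_weight /powR gt_eqF// mulrN opprK -mulrN exprMn.
  by field; exact: factr_neq0.
- by move=> w _; rewrite lee_fin mulr_ge0 ?powR_ge0 ?exprn_ge0 ?(ltW (tau_gt0 _)).
- by apply/measurable_EFinP; exact: measurable_moment.
- by rewrite divr_ge0// exprn_ge0// oppr_ge0 ln_le0// ltW.
Qed.

Lemma Bk_mixture_df (k : nat) (x : R) : (0 < k)%N -> 0 <= F x -> F x <= 1 ->
  Bk P F tau k x = mixture_df tau k (F x).
Proof.
move=> k0; rewrite le_eqVlt => /predU1P[Fx0 _|u0].
  rewrite -Fx0 mixture_df_eq0// /Bk -Fx0; apply: big1 => i _.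
  rewrite unlock integral0_eq ?mulr0// => w _.
  by rewrite powR0 ?mulr0// gt_eqF.
rewrite le_eqVlt => /predU1P[Fx1|u1].
  rewrite Fx1 mixture_df_eq1// /Bk Fx1 -(prednK k0) big_ord_recl big1; last first.
    by move=> i _; rewrite ln1 oppr0 expr0n mul0r mul0r.
  rewrite expr0 divr1 mul1r addr0 unlock.
  under eq_integral do rewrite powR1 expr0 mulr1.
  rewrite [X in fine X](_ : _ = 1%E)// integral_cst// mul1e.
  exact: probability_setT.
apply: EFin_inj; rewrite mixture_dfE// /Bk -sumEFin.
under eq_bigr do rewrite fine_term//.
rewrite -ge0_integral_sum//.
- apply: eq_integral => w _; rewrite sumEFin; congr (_%:E).
  by rewrite erlang_tail_logE// ltW.
- move=> i; apply/measurable_EFinP.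
  apply: (@measurableT_comp _ _ _ _ _ _ (poisson_weight i)).
    exact: continuous_measurable_fun (@continuous_poisson_weight R i).
  by apply: measurable_funM.
- move=> i w _; rewrite lee_fin poisson_weight_ge0// mulr_ge0 ?(ltW (tau_gt0 w))//.
  by rewrite oppr_ge0 ln_le0// ltW.
Qed.

End Bk_mixture.

Section right_extremity.
Context {R : realType}.
Implicit Types F : R -> R.

Lemma eq_right_extremity F G : (forall x, (F x < 1) = (G x < 1)) ->
  right_extremity F = right_extremity G.
Proof.
move=> FG; rewrite /right_extremity; congr (ereal_sup (_ @` _)).
by apply/funext => x /=; rewrite FG.
Qed.

(** At a finite right extremity [r], [F] is at least 1 to the right of [r], so continuity gives
    [F r = 1]. The value [-oo] would force [1 <= F] everywhere, against the limit 0 at [-oo]. *)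
Lemma df_cvg_increasing_to F : is_df F -> continuous F ->
  F x @[x --> increasing_to (right_extremity F)] --> (1 : R)^'-.
Proof.
move=> F_df F_cont.
have lt1 x : (x%:E < right_extremity F)%E -> F x < 1.
  move=> /ereal_sup_gt[_ [y /= Fy <-]]; rewrite lte_fin => xy.
  by rewrite (le_lt_trans _ Fy)// (df_nondecreasing F_df)// ltW.
have ge1 x : (right_extremity F < x%:E)%E -> 1 <= F x.
  move=> rx; rewrite leNgt; apply/negP => Fx.
  move: rx; rewrite ltNge => /negP; apply.
  by apply: ereal_sup_ubound; exists x.
(* The target filter excludes 1 itself, so besides the limit one needs [F x < 1] eventually. *)
have within1 (G : set_system R) : Filter G -> F x @[x --> G] --> (1 : R) ->
    (\forall x \near G, F x < 1) -> F x @[x --> G] --> (1 : R)^'-.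
  move=> GF c l A; rewrite /at_left /within /= => h.
  have := c _ h; apply: filterS2 l => x Fx; exact.
case: right_extremity lt1 ge1 => [r| |] lt1 ge1 /=.
- have cr : F x @[x --> r^'+] --> F r by apply: cvg_at_right_filter; exact: F_cont.
  have Fr : F r = 1.
    apply/eqP; rewrite eq_le df_le1//=.
    apply: (cvgr_to_ge cr); near=> y; apply: ge1; rewrite lte_fin.
    by near: y; exact: nbhs_right_gt.
  apply: within1.
    by rewrite -Fr; apply: cvg_at_left_filter; exact: F_cont.
  near=> y; apply: lt1; rewrite lte_fin; near: y; exact: nbhs_left_lt.
- apply: within1; first exact: df_cvgy.
  by apply: nearW => x; apply: lt1; rewrite ltry.
- have : (1 : R) <= 0.
    apply: (cvgr_to_ge (df_cvgNy F_df)); apply: nearW => x.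
    by apply: ge1; rewrite ltNyr.
  by rewrite ler10.
Unshelve. all: by end_near. Qed.

End right_extremity.

(** The tail equivalence carries a moment condition because the limit of the ratio is E[tau^k] / k!.
    If this moment is infinite, Fatou's lemma makes the ratio tend to [+oo]. The order is positive
    since [B_0] is the empty sum 0, not a df. *)
Theorem theorem4p9 (d : measure_display) (T : measurableType d) (R : realType)
    (P : probability T R) (F f : R -> R) (tau : {RV P >-> R})
    (F_df : is_df F) (F_pdf : is_pdf F f) (tau_gt0 : forall w : T, 0 < tau w)
    (k : nat) (k_gt0 : (0 < k)%N) :
  [/\ is_df (Bk P F tau k),
      right_extremity (Bk P F tau k) = right_extremity F,
      is_pdf (Bk P F tau k) (bk P F f tau k) &
      forall x : R, 0 < F x ->
        Bk P F tau k.+1 x = Bk P F tau k x +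
          (- ln (F x)) ^+ k / (k`!)%:R *
            fine 'E_P[(fun w => tau w ^+ k * F x `^ tau w)%R]%E]
  /\ (('E_P[(fun w => tau w ^+ k)%R] < +oo)%E ->
      tail_equivalent (Bk P F tau k) (Hk F k)).
Proof.
have F0 := df_ge0 F_df; have F1 := df_le1 F_df.
have F_cont := pdf_continuous F_df F_pdf.
have BE : Bk P F tau k = mixture_df tau k \o F.
  by apply/funext => x; rewrite Bk_mixture_df.
have M_cont := continuous_mixture_df tau_gt0 k_gt0.
(* The right extremity depends only on the set where a function is below 1, so this equivalence
   transfers it from [F] to [B_k]. *)
have M_lt1 x : (mixture_df tau k (F x) < 1) = (F x < 1).
  apply/idP/idP; last exact: mixture_df_lt1.
  by apply: contraTT; rewrite -!leNgt => Fx; rewrite mixture_df_eq1.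
have rB : right_extremity (Bk P F tau k) = right_extremity F.
  by rewrite BE; exact: eq_right_extremity.
split; [split|].
- have ndB : {homo mixture_df tau k \o F : x y / x <= y}.
    by move=> x y xy; exact/mixture_df_nd/df_nondecreasing.
  have rcB : right_continuous (mixture_df tau k \o F).
    move=> x; apply: cvg_at_right_filter.
    by apply: continuous_comp; [exact: F_cont|exact: M_cont].
  have BNy : (mixture_df tau k \o F) @ -oo --> (0 : R).
    rewrite -(mixture_df_eq0 tau_gt0 k (lexx 0)).
    exact: (cvg_comp _ _ (df_cvgNy F_df) (M_cont 0)).
  have By : (mixture_df tau k \o F) @ +oo --> (1 : R).
    rewrite -[X in _ --> X](mixture_df_eq1 tau_gt0 k_gt0 (lexx 1)).
    exact: (cvg_comp _ _ (df_cvgy F_df) (M_cont 1)).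
  pose iC := isCumulative.Build R _ R _ ndB rcB.
  pose iB := isCumulativeBounded.Build R 0 1 _ BNy By.
  pose G : cumulativeBounded (0 : R) (1 : R) := HB.pack (mixture_df tau k \o F) iC iB.
  by exists G; rewrite BE.
- exact: rB.
- have [mf f0 FE] := F_pdf.
  have dens0 u : 0 <= u -> u <= 1 -> 0 <= mixture_density tau k u.
    move=> u0 u1; rewrite /mixture_density mulr_ge0//.
      by rewrite divr_ge0// exprn_ge0// oppr_ge0 ln_le0.
    rewrite fine_ge0// unlock; apply: integral_ge0 => w _.
    by rewrite lee_fin mulr_ge0 ?powR_ge0 ?exprn_ge0 ?(ltW (tau_gt0 _)).
  split.
  + apply: measurable_funM => //.
    apply: (measurableT_comp (f := mixture_density tau k)).
      exact: measurable_mixture_density.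
    exact: continuous_measurable_fun.
  + by move=> x; rewrite /bk mulr_ge0//; exact: dens0.
  (* [B_k x] becomes the integral of the mixture density over [[0, F x]], which the probability
     integral transform pulls back to the half-line up to [x]. *)
  + move=> x; rewrite BE /= -(prednK k_gt0) -integral_mixture_density//.
    rewrite -(ge0_integral_df_comp F_df F_pdf
      (h := fun u => `|mixture_density tau k.-1.+1 u|%:E)).
    * apply: eq_integral => y _; rewrite -EFinM ger0_norm// (prednK k_gt0).
      exact: dens0.
    * apply/measurable_EFinP; apply: measurableT_comp => //.
      exact: measurable_mixture_density.
    * by move=> u; rewrite lee_fin.
- by move=> x _; rewrite /Bk big_ord_recr.
move=> moment_lty; split.
  rewrite rB; apply: eq_right_extremity => x.
  rewrite /Hk gtrBl lt0r expf_eq0 k_gt0 subr_eq0.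
  by rewrite exprn_ge0 ?subr_ge0// andbT lt_neqAle F1 andbT eq_sym.
have [l l0 cl] := cvg_onem_mixture_df tau_gt0 moment_lty.
exists l => //; rewrite rB.
rewrite (_ : (fun x => _) =
  (fun u => (1 - mixture_df tau k u) / (1 - u) ^+ k) \o F); last first.
  by apply/funext => x; rewrite BE /Hk /= subKr.
exact: (cvg_comp _ _ (df_cvg_increasing_to F_df F_cont) cl).
Qed.
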